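(* Let $G$ be a graph of treewidth $t$ and let $\mathcal H$ be a non-piercing family of subgraphs of $G$. Then $(G,\mathcal H)$ admits a dual support $Q^*$ with $\mathrm{tw}(Q^* )\le 2^{4(t+1)}$.
   Context: All graphs are finite and simple. A subgraph $H$ of a graph $G$ is identified with its vertex set $V(H)$ (subgraphs are taken to be induced), and intersections, differences and containments of subgraphs refer to their vertex sets. A family $\mathcal H$ of subgraphs of $G$ is non-piercing if every $H\in\mathcal H$ induces a connected subgraph of $G$ and, for all $H,H'\in\mathcal H$, the induced subgraph $G[V(H)\setminus V(H')]$ is connected (an empty vertex set is regarded as connected). A dual support for $(G,\mathcal H)$ is a graph $Q^*$ whose vertex set is $\mathcal H$ (one vertex per member) such that for every $v\in V(G)$ the set $\mathcal H_v=\{H\in\mathcal H: v\in V(H)\}$ induces a connected subgraph of $Q^*$. $\mathrm{tw}$ denotes treewidth. *)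

(* Defs.v *)
(* Finite simple graphs as symmetric irreflexive relations
   on a finType; subgraphs identified with vertex sets {set T}. *)
From mathcomp Require Import all_boot.
Set Implicit Arguments. Unset Strict Implicit. Unset Printing Implicit Defensive.

Section Graphs.
Variable T : finType.

Definition simple_graph (e : rel T) : Prop := symmetric e /\ irreflexive e.

Definition induced (e : rel T) (A : {set T}) : rel T :=
  [rel x y | [&& x \in A, y \in A & e x y]].

(* A induces a connected subgraph (the empty set counts as connected) *)
Definition connected_in (e : rel T) (A : {set T}) : Prop :=
  forall x y, x \in A -> y \in A -> connect (induced e A) x y.

Definition is_tree (e : rel T) : Prop :=
  [/\ simple_graph e, [set: T] != set0, connected_in e [set: T]
    & forall c : seq T, cycle e c -> uniq c -> size c <= 2].
End Graphs.

Definition tree_decomposition (T B : finType) (e : rel T) (eB : rel B)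
  (bag : B -> {set T}) : Prop :=
  [/\ is_tree eB,
      forall v : T, exists b, v \in bag b,
      forall u v : T, e u v -> exists b, (u \in bag b) && (v \in bag b)
    & forall v : T, connected_in eB [set b | v \in bag b]].

Definition tw_le (T : finType) (e : rel T) (k : nat) : Prop :=
  exists (B : finType) (eB : rel B) (bag : B -> {set T}),
    tree_decomposition e eB bag /\ forall b, #|bag b| <= k.+1.

Definition treewidth (T : finType) (e : rel T) (t : nat) : Prop :=
  tw_le e t /\ forall k, tw_le e k -> t <= k.

Definition non_piercing (T I : finType) (e : rel T) (H : I -> {set T}) : Prop :=
  (forall i, connected_in e (H i)) /\
  (forall i j, connected_in e (H i :\: H j)).

Definition dual_support (T I : finType) (e : rel T) (H : I -> {set T})
  (Q : rel I) : Prop :=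
  forall v : T, connected_in Q [set i | v \in H i].

(* Main.v *)
Require Import Defs.
From mathcomp Require Import all_boot.
Set Implicit Arguments. Unset Strict Implicit. Unset Printing Implicit Defensive.

(** Fix a rooted binary tree decomposition of G. Let A be the root bag and C1, C2
    the parts of G hanging below it. If two members of the family have the same
    trace on A, then by non-piercing their difference lies in a single component
    of G - A, so inside C1, inside C2, or outside both. Hence, for each nonempty
    trace, members that are inclusion-maximal within C1 but differ there coincide
    outside C1, and similarly for C2. For each trace we pick one such maximal member
    g1 for C1 and one g2 for C2. A member whose part in C1 is not dominated by g1 is
    passed on to the recursive problem for C1; it agrees with g1 outside C1, so it
    suffices that the support built there links all members containing that outer
    part of g1. Members dominated on both sides stay at the root, each put in a bag
    together with a fixed set of representatives: all g1, all g2, the members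
    prescribed by the parent, and one member through each vertex of A and through each
    outer part prescribed by the parent. Writing n = 2^(t+1), there are at most
    4 n + t + 1 <= n^4 representatives. *)

(** * Reachability *)

Section ConnectFacts.
Variable T : finType.
Implicit Types (r : rel T) (D : {set T}).

Lemma connect_stable r D x y :
  (forall a b, a \in D -> r a b -> b \in D) ->
  connect r x y -> x \in D -> y \in D.
Proof.
move=> cl /connectP[p].
elim: p x => [|z p IHp] x /=; first by move=> _ ->.
by case/andP=> rxz /IHp h /h{}h xD; apply: h; apply: cl rxz.
Qed.

End ConnectFacts.

(** * From lists of bags to tree decompositions *)

Section RunningIntersection.
Variable I : finType.
Implicit Types (s : seq {set I}).

(* Running intersection: a list of bags with this property is a tree
   decomposition of [cobag s], each bag after the first being hung on an earlier one. *)
Definition rip s := forall i, 0 < i < size s ->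
  exists2 j, j < i & forall k, k < i ->
    nth set0 s i :&: nth set0 s k \subset nth set0 s j.

Definition cobag s : rel I := [rel x y | has (fun b : {set I} => (x \in b) && (y \in b)) s].

Lemma cobag_sym s : symmetric (cobag s).
Proof. by move=> x y; apply: eq_has => b; rewrite andbC. Qed.

Lemma cobag_cat s1 s2 x y : cobag (s1 ++ s2) x y = cobag s1 x y || cobag s2 x y.
Proof. exact: has_cat. Qed.

(** Gluing: the head of [s2] is hung on [r], and all other bags keep their parents. *)
Lemma rip_cat s1 s2 r :
  rip s1 -> rip s2 -> r \in s1 ->
  (forall x, has (fun b : {set I} => x \in b) s1 -> has (fun b : {set I} => x \in b) s2 ->
     (x \in r) && (x \in head set0 s2)) ->
  rip (s1 ++ s2).
Proof.
move=> h1 h2 rs1 ov i; rewrite size_cat => /andP[i0 ilt].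
have in1 k x : k < size s1 -> x \in nth set0 s1 k -> has (fun b : {set I} => x \in b) s1.
  by move=> ks xk; apply/hasP; exists (nth set0 s1 k); rewrite ?mem_nth.
have in2 k x : k < size s2 -> x \in nth set0 s2 k -> has (fun b : {set I} => x \in b) s2.
  by move=> ks xk; apply/hasP; exists (nth set0 s2 k); rewrite ?mem_nth.
have [is1|s1i] := ltnP i (size s1).
  have [|j ji hj] := h1 i; first by rewrite i0.
  exists j => // k ki; rewrite !nth_cat is1 (ltn_trans ki is1) (ltn_trans ji is1).
  exact: hj.
have i2 : i - size s1 < size s2 by rewrite ltn_subLR.
have [i'0|i'0] := posnP (i - size s1).
  have ei : i = size s1 by apply/eqP; rewrite eqn_leq s1i andbT -subn_eq0 i'0.
  exists (index r s1); first by rewrite ei index_mem.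
  move=> k ki; rewrite !nth_cat index_mem rs1 nth_index //.
  have ks : k < size s1 by rewrite -ei.
  rewrite ks ltnNge s1i /=; apply/subsetP=> x /setIP[x2 x1].
  by case/andP: (ov x (in1 _ _ ks x1) (in2 _ _ i2 x2)).
have [|j ji hj] := h2 (i - size s1); first by rewrite i'0.
exists (size s1 + j); first by rewrite -ltn_subRL.
move=> k ki; rewrite !nth_cat (ltnNge i) s1i (ltnNge (_ + _)) leq_addr /= addKn.
have [ks|ks] := ltnP k (size s1); last by apply: hj; rewrite ltn_sub2r // (leq_ltn_trans ks).
(* A member shared with a bag of [s1] lies in the head of [s2], so the inclusion for bag 0 of [s2]
   covers it. *)
apply/subsetP=> x /setIP[x2 x1]; apply: (subsetP (hj 0 i'0)).
by rewrite inE x2 nth0; case/andP: (ov x (in1 _ _ ks x1) (in2 _ _ i2 x2)).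
Qed.

(** The tree has the list positions as nodes, each positive position joined to one parent supplied
    by [rip]. *)
Lemma rip_tw_le s (k : nat) : s != [::] -> rip s ->
  (forall x, has (fun b : {set I} => x \in b) s) -> {in s, forall b : {set I}, #|b| <= k.+1} ->
  tw_le [rel x y | (x != y) && cobag s x y] k.
Proof.
case: s => // r s _ hr cov bnd; set s' := r :: s in hr cov bnd *.
pose B : finType := 'I_(size s').
pose bag (b : B) := nth set0 s' b.
pose ok (i j : B) := (j < i) && [forall k : B, (k < i) ==> (bag i :&: bag k \subset bag j)].
(* The default [i] is taken only at the root, index 0. *)
pose p (i : B) : B := if [pick j | ok i j] is Some j then j else i.
have pP (i : B) : 0 < i -> ok i (p i).
  move=> i0; rewrite /p; case: pickP => // none.
  have [|j ji hj] := hr i; first by rewrite i0 ltn_ord.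
  have js := ltn_trans ji (ltn_ord i).
  have := none (Ordinal js); rewrite /ok /= ji /= => /negP[].
  by apply/forallP=> l; apply/implyP=> /hj.
have plt (i : B) : 0 < i -> p i < i by move/pP/andP=> [].
pose eB : rel B := [rel i j : B | ((0 < i) && (p i == j)) || ((0 < j) && (p j == i))].
have eBs : symmetric eB by move=> i j; rewrite /eB /= orbC.
have eBp (i j : B) : eB i j -> j <= i -> j = p i.
  rewrite /eB => /orP[]/andP[i0 /eqP <-] // le; have := plt j i0.
  by rewrite ltnNge le.
have eBi : irreflexive eB.
  move=> i; apply/negbTE/negP; rewrite /eB /= orbb => /andP[i0 /eqP pi].
  by have := plt i i0; rewrite pi ltnn.
(* Connectedness by descent: of two distinct indices in [D], the larger one moves to its parent. *)
have conn (D : {set B}) (Dp : forall i : B, i \in D -> (forall j, j \in D -> i <= j) \/ 0 < i /\ p i \in D) :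
    connected_in eB D.
  have sym : connect_sym (induced eB D).
    by apply: sym_connect_sym => x y; rewrite /induced /= eBs andbCA.
  have key (x y : B) : x \in D -> y \in D -> x <= y -> connect (induced eB D) x y.
    move=> xD yD.
    have [m le_y] := ubnP (x + y); elim: m x y xD yD le_y => // m IH x y xD yD le_m xy.
    have [<-|xny] := eqVneq x y; first exact: connect0.
    have xlty : x < y by rewrite ltn_neqAle xny.
    case: (Dp y yD) => [/(_ x xD)|[y0 pyD]]; first by rewrite leqNgt xlty.
    apply: (@connect_trans _ _ (p y)); last first.
      by apply: connect1; rewrite /induced /eB /= pyD yD y0 eqxx orbT.
    have lt : x + p y < m by rewrite -ltnS (leq_trans _ le_m) // ltnS ltn_add2l plt.
    have [le|lt'] := leqP x (p y); first exact: IH.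
    by rewrite sym; apply: IH => //; rewrite ?(ltnW lt') // addnC.
  move=> x y xD yD; have [xy|/ltnW yx] := leqP x y; first exact: key.
  by rewrite sym; apply: key.
exists B, eB, bag; split; last by move=> b; apply: bnd; rewrite mem_nth.
split.
- split=> //.
  + by apply/set0Pn; exists ord0.
  + apply: conn => i _; have [i0|i0] := posnP i; last by right; rewrite inE.
    by left=> j _; rewrite i0.
  + move=> c cyc un; rewrite leqNgt; apply/negP=> c2.
    have [x0 x0c] : exists x, x \in c by case: (c) c2 => // x c' _; exists x; rewrite mem_head.
    (* Both cycle neighbours of the largest index must be its parent, which a cycle of more than two
       distinct vertices forbids. *)
    have [m mc mmax] : exists2 m, m \in c & {in c, forall x : B, x <= m}.
      case: (@arg_maxnP _ x0 (mem c) (@nat_of_ord _) x0c) => m mc mm.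
      by exists m => // x xc; apply: mm.
    have [n c' ec] := rot_to mc.
    have un' : uniq (m :: c') by rewrite -ec rot_uniq.
    have cyc' : cycle eB (m :: c') by rewrite -ec rot_cycle.
    have sz : 1 < size c' by rewrite -ltnS -[(size c').+1]/(size (m :: c')) -ec size_rot.
    have mx' x : x \in c' -> x <= m.
      by move=> xc'; apply: mmax; rewrite -(mem_rot n) ec inE xc' orbT.
    case: c' sz un' cyc' mx' {ec} => [//|a c']; case/lastP: c' => [//|c' z] _.
    move=> un' cyc' mx'.
    move: cyc'; rewrite /= rcons_path => /andP[ema /andP[_]].
    rewrite last_rcons eBs => emz.
    have ea := eBp _ _ ema (mx' a (mem_head _ _)).
    have ez : z = p m by apply: eBp emz _; apply: mx'; rewrite inE mem_rcons mem_head orbT.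
    by move: un'; rewrite /= mem_rcons inE ea -ez eqxx andbF.
- move=> v; have /hasP[b bs vb] := cov v.
  have lt : index b s' < size s' by rewrite index_mem.
  by exists (Ordinal lt); rewrite /bag /= nth_index.
- move=> u v /andP[_ /hasP[b bs uvb]].
  have lt : index b s' < size s' by rewrite index_mem.
  by exists (Ordinal lt); rewrite /bag /= nth_index.
- move=> v; apply: conn => i; rewrite inE => vi.
  (* If an earlier bag contains [v], so does the parent; otherwise [i] is the first bag containing
     [v]. *)
  have [/existsP[j /andP[ji vj]]|none] := boolP [exists j : B, (j < i) && (v \in bag j)].
    right; have i0 : 0 < i by apply: leq_ltn_trans ji.
    split=> //; rewrite inE; have /andP[_ /forallP/(_ j)] := pP i i0.
    by rewrite ji => /subsetP; apply; rewrite inE vi.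
  left=> j; rewrite inE => vj; rewrite leqNgt; apply: contra none => ji.
  by apply/existsP; exists j; rewrite ji.
Qed.

End RunningIntersection.

(** * Rooted binary tree decompositions *)

Section RootedDecomposition.
Variables (T : finType) (e : rel T) (t : nat).

(* [rooted_dec V A]: V is the union of the bags of a subtree with root bag A.
   The edge conditions are global: V_i meets the rest of G only through A. *)
Inductive rooted_dec : {set T} -> {set T} -> Prop :=
| rooted_leaf (A : {set T}) : #|A| <= t.+1 -> rooted_dec A A
| rooted_node (A V1 A1 V2 A2 : {set T}) :
    #|A| <= t.+1 -> rooted_dec V1 A1 -> rooted_dec V2 A2 ->
    A :&: V1 \subset A1 -> A :&: V2 \subset A2 -> V1 :&: V2 \subset A ->
    (forall u v, u \in V1 :\: A -> e u v -> v \in V1 :|: A) ->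
    (forall u v, u \in V2 :\: A -> e u v -> v \in V2 :|: A) ->
    rooted_dec (A :|: V1 :|: V2) A.

(** A path with both ends in [D] leaves [D] only from [y] and returns only to [y], so its excursions
    can be cut out. *)
Lemma connected_in_side (B : finType) (eB : rel B) (D Y : {set B}) (y : B) :
  symmetric eB ->
  (forall a b, a \in D -> b \notin D -> eB a b -> a = y) ->
  connected_in eB Y -> connected_in eB (Y :&: D).
Proof.
move=> sB cross cY a b /setIP[aY aD] /setIP[bY bD].
have /connectP[p pp lb] := cY a b aY bY.
(* The second half handles a path currently on an excursion: it is resumed at [y]. *)
suff [h _] : (a \in D -> connect (induced eB (Y :&: D)) a b) /\
   (a \notin D -> connect (induced eB (Y :&: D)) y b) by apply: h.
elim: p a pp lb {aY aD} => [|c p IH] a /=; first by move=> _ <-; rewrite bD; split.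
case/andP=> /and3P[aY cYm eac] pp lb; have [h1 h2] := IH c pp lb.
split=> [aD|aN].
  have [cD|cN] := boolP (c \in D); last by rewrite (cross a c aD cN eac); apply: h2.
  apply: connect_trans (h1 cD); apply: connect1.
  by rewrite /induced /= !inE aY aD cYm cD.
have [cD|cN] := boolP (c \in D); last exact: h2.
by rewrite -(cross c a cD aN) ?h1 // sB.
Qed.

(** If [x] or [y] were missing from [Y], no edge inside [Y] would leave [D], and [b] could not be
    reached from [a]. *)
Lemma connected_in_cross (B : finType) (eB : rel B) (D Y : {set B}) (x y a b : B) :
  (forall a b, a \in D -> b \notin D -> eB a b -> a = y /\ b = x) ->
  connected_in eB Y -> a \in Y -> b \in Y -> a \in D -> b \notin D ->
  (x \in Y) && (y \in Y).
Proof.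
move=> cross cY aY bY aD bN; apply: contraT => nxy.
suff : b \in D by rewrite (negbTE bN).
apply: (connect_stable _ (cY a b aY bY) aD) => c d cD /and3P[cYm dY ecd].
apply: contraT => dN; have [cy dx] := cross c d cD dN ecd.
by move: nxy; rewrite -cy -dx cYm dY.
Qed.

(** [D] is what [y] reaches without the step from [y] to [x]. Were [x] reached, a simple path closed
    up by the edge would be a cycle of length above 2. *)
Lemma tree_edge_bridge (B : finType) (eB : rel B) (x y : B) :
  is_tree eB -> eB x y -> exists D : {set B},
  [/\ y \in D, x \notin D &
     forall a b, a \in D -> b \notin D -> eB a b -> a = y /\ b = x].
Proof.
move=> [[sB iB] _ _ acyc] exy.
pose e' := [rel a b | eB a b && ~~ ((a == y) && (b == x))].
exists [set z | connect e' y z]; split; first by rewrite inE connect0.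
  rewrite inE; apply/negP=> /connectP[p pp lx].
  case/shortenP: pp lx => q qq uq _ lx.
  have cyc : cycle eB (y :: q).
    rewrite /= rcons_path -lx exy andbT.
    by apply: sub_path qq => a b /andP[].
  have := acyc _ cyc uq.
  case: q qq lx {uq cyc} => [_ /= xy|a [|c q]] //=.
    by move: exy; rewrite xy iB.
  by rewrite andbT => /andP[_ h] xa; move: h; rewrite xa !eqxx.
move=> a b; rewrite !inE => ya yb eab.
suff /andP[/eqP-> /eqP->] : (a == y) && (b == x) by [].
apply: contraNT yb => nab.
by apply: connect_trans ya (connect1 _); rewrite /= eab.
Qed.

(** Nodes of any degree are made binary by splitting off one neighbour [y] of the root [x] at a
    time; the rest stays rooted at [x]. *)
Lemma rooted_dec_exists : tw_le e t -> exists A, rooted_dec [set: T] A.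
Proof.
case=> B [eB [bag [[tree cov edg con] bnd]]].
have [[sB iB] /set0Pn[x0 _] cB _] := tree.
pose U (X : {set B}) := \bigcup_(b in X) bag b.
(* Generalised to subtrees: a vertex seen both inside and outside [X] must lie in the bag of the
   root [x]. *)
suff main n (X : {set B}) x : #|X| < n -> x \in X -> connected_in eB X ->
    (forall v z z', z \in X -> z' \notin X -> v \in bag z -> v \in bag z' -> v \in bag x) ->
    rooted_dec (U X) (bag x).
  exists (bag x0); have := main #|[set: B]|.+1 [set: B] x0 (ltnSn _) (in_setT _) cB.
  have -> : U [set: B] = [set: T].
    apply/setP=> v; rewrite inE; apply/bigcupP; have [b vb] := cov v.
    by exists b.
  by apply=> v z z' _; rewrite inE.
elim: n X x => // n IH X x Xn xX cX inv.
have [/existsP[y /andP[yX exy]]|none] := boolP [exists y, (y \in X) && eB x y]; last first.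
  have -> : X = [set x].
    apply/eqP; rewrite eqEsubset sub1set xX andbT; apply/subsetP=> z zX.
    rewrite inE; apply: contraR none => zx.
    have /connectP[[|y p] /=] := cX x z xX zX; first by move=> _ ez; rewrite ez eqxx in zx.
    case/andP=> /and3P[_ yX exy] _ _; apply/existsP; exists y; exact/andP.
  by rewrite /U big_set1; apply: rooted_leaf.
have [D [yD xD cross]] := tree_edge_bridge tree exy.
have crossv v z z' : z \in D -> z' \notin D -> v \in bag z -> v \in bag z' ->
    (v \in bag x) && (v \in bag y).
  move=> zD z'D vz vz'; have := connected_in_cross (x := x) (y := y) (a := z) (b := z') cross (con v).
  by rewrite !inE; apply.
have -> : U X = bag x :|: U (X :\: D) :|: U (X :&: D).
  have /setUidPr-> : bag x \subset U (X :\: D) by apply: bigcup_sup; rewrite inE xD.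
  by rewrite /U -bigcup_setU setUC setID.
have edgeU (Y : {set B}) u v : (forall z z', z \in Y -> z' \notin Y -> u \in bag z -> u \in bag z' -> u \in bag x) ->
    u \in U Y :\: bag x -> e u v -> v \in U Y :|: bag x.
  move=> invY; rewrite in_setD => /andP[ux /bigcupP[z zY uz]] euv.
  have [b /andP[ub vb]] := edg u v euv.
  rewrite in_setU; apply/orP; left; apply/bigcupP; exists b => //.
  by apply: contraR ux => bY; apply: invY uz ub.
have inv1 v z z' : z \in X :\: D -> z' \notin X :\: D -> v \in bag z -> v \in bag z' ->
    v \in bag x.
  rewrite !inE => /andP[zD zX]; rewrite negb_and negbK => /orP[z'D|z'X] vz vz'.
    by case/andP: (crossv v z' z z'D zD vz' vz).
  exact: inv zX z'X vz vz'.
have inv2 v z z' : z \in X :&: D -> z' \notin X :&: D -> v \in bag z -> v \in bag z' ->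
    (v \in bag x) && (v \in bag y).
  rewrite !inE => /andP[zX zD]; rewrite negb_and => /orP[z'X|z'D] vz vz'.
    by apply: (crossv v z x) => //; apply: (inv v z z').
  exact: crossv zD z'D vz vz'.
(* The first child reuses the bag of [x]; the second is the subtree beyond the bridge, rooted at
   [y]. *)
apply: (@rooted_node _ _ (bag x) _ (bag y)) => //.
- apply: IH => //.
  + rewrite -ltnS (leq_trans _ Xn) // ltnS proper_card // properE subsetDl /=.
    by apply/subsetPn; exists y; rewrite ?inE ?yD.
  + by rewrite inE xD.
  + rewrite setDE; apply: (connected_in_side (y := x)) cX => // a b.
    rewrite !inE negbK => aD bD eab.
    by have [] := cross b a bD aD; rewrite ?(sB b a).
- apply: IH => //.
  + rewrite -ltnS (leq_trans _ Xn) // ltnS proper_card // properE subsetIl /=.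
    by apply/subsetPn; exists x; rewrite ?inE ?(negbTE xD) ?andbF.
  + by rewrite inE yX.
  + by apply: (connected_in_side (y := y)) cX => // a b aD bD /(cross a b aD bD)[].
  + by move=> v z z' zX z'X vz vz'; case/andP: (inv2 v z z' zX z'X vz vz').
- exact: subsetIl.
- apply/subsetP=> v /setIP[vx /bigcupP[z]]; rewrite inE => /andP[zX zD] vz.
  by case/andP: (crossv v z x zD xD vz vx).
- apply/subsetP=> v /setIP[/bigcupP[z' z'X vz'] /bigcupP[z zX vz]].
  apply: (inv1 v z' z) => //; move: zX; rewrite !inE => /andP[_ ->] //.
- by move=> u v; apply: edgeU => z z'; apply: inv1.
- move=> u v; apply: edgeU => z z' zX z'X uz uz'.
  by case/andP: (inv2 u z z' zX z'X uz uz').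
Qed.

End RootedDecomposition.

(** * Stars of bags and connection through hubs *)

Section BagGraphs.
Variable I : finType.

(** The bags of distinct [i] meet only in [R], so all of them hang on the first bag. *)
Lemma rip_star (F R : {set I}) : rip (R :: [seq i |: R | i <- enum F]).
Proof.
case=> [//|i] /=; rewrite size_map ltnS => ilt; exists 0 => // -[|k] ki /=.
  exact: subsetIr.
have ks : k < size (enum F) by apply: ltn_trans ilt.
have x0 : I by case: (enum F) ilt => // x.
rewrite !(nth_map x0) //; apply/subsetP=> x; rewrite !inE.
case/andP=> /orP[/eqP->|//] /orP[|//].
by rewrite nth_uniq ?enum_uniq // gtn_eqF.
Qed.

Lemma cobag_star (F R : {set I}) i r : i \in F -> r \in R ->
  cobag (R :: [seq i |: R | i <- enum F]) i r.
Proof.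
move=> iF rR; apply/hasP; exists (i |: R); last by rewrite !inE eqxx rR orbT.
by rewrite in_cons; apply/orP; right; apply/mapP; exists i; rewrite ?mem_enum.
Qed.

Lemma connect_inducedS (r r' : rel I) (D D' : {set I}) x y :
  subrel r r' -> D \subset D' ->
  connect (induced r D) x y -> connect (induced r' D') x y.
Proof.
move=> rr' /subsetP DD'; apply: connect_sub => a b /and3P[aD bD rab].
by apply: connect1; rewrite /induced /= !DD' // rr'.
Qed.

Lemma connect_induced1 (r : rel I) (D : {set I}) x y :
  x \in D -> y \in D -> r x y -> connect (induced r D) x y.
Proof. by move=> xD yD rxy; apply: connect1; rewrite /induced /= xD yD. Qed.

Lemma connected_in_hub (r : rel I) (D : {set I}) : symmetric r ->
  (forall x y, x \in D -> y \in D -> exists2 z, connect (induced r D) x z & connect (induced r D) y z) ->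
  connected_in r D.
Proof.
move=> rs hub x y xD yD; have [z xz yz] := hub x y xD yD.
apply: connect_trans xz _; rewrite sym_connect_sym // => a b.
by rewrite /induced /= rs andbCA.
Qed.

End BagGraphs.

(** * Supports with prescribed links *)

Section DualSupport.
Variables (T I : finType) (e : rel T) (H : I -> {set T}).
Hypothesis H_conn : forall i, connected_in e (H i).
Hypothesis H_diff : forall i j, connected_in e (H i :\: H j).

Implicit Types (A C D S l : {set T}) (F W R : {set I}) (P : {set {set T}}).

(** For [C] disjoint from [A], this makes [C] a union of components of G - A. *)
Definition sealed A C := forall u v, u \in C -> e u v -> v \in C :|: A.
Definition part_le C i j := H i :&: C \subset H j.
Definition above F l := [set i in F | l \subset H i].

(* A solution on the subfamily F: a tree decomposition whose first bag r contains W
   and whose co-bag graph links, for each l in P, the members containing l. *)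
Definition bag_support k F W P r s :=
  [/\ rip (r :: s), W \subset r, {in r :: s, forall b : {set I}, #|b| <= k.+1},
      forall i, has (fun b : {set I} => i \in b) (r :: s) = (i \in F)
    & forall l, l \in P -> connected_in (cobag (r :: s)) (above F l)].

Lemma above_representatives F P : exists R : {set I},
  [/\ R \subset F, #|R| <= #|P| &
      forall l i, l \in P -> i \in above F l -> exists2 j, j \in R & j \in above F l].
Proof.
have [->|[i0 i0F]] := set_0Vmem F.
  by exists set0; rewrite sub0set cards0; split=> // l i _; rewrite !inE.
(* The default [i0] keeps the image inside [F] when no member contains [l]. *)
pose f l := if [pick i in above F l] is Some i then i else i0.
have fF l : f l \in F.
  by rewrite /f; case: pickP => // i; rewrite inE => /andP[].
exists (f @: P); rewrite leq_imset_card; split=> //.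
  by apply/subsetP=> _ /imsetP[l _ ->].
move=> l i lP il; exists (f l); first exact: imset_f.
by rewrite /f; case: pickP => [//|/(_ i)]; rewrite il.
Qed.

(** * Trace classes on a separator and their maximal members *)

Lemma connected_avoiding (A C X : {set T}) x :
  sealed A C ->
  connected_in e X -> [disjoint X & A] -> x \in X -> x \in C -> X \subset C.
Proof.
move=> clC cX dXA xX xC; apply/subsetP=> y yX.
apply: (connect_stable _ (cX x y xX yX) xC) => a b aC /and3P[aX bX eab].
by have := clC a b aC eab; rewrite inE (disjointFr dXA bX) orbF.
Qed.

(* Where non-piercing is used: if two members have the same trace on the
   separator A, then their difference lies on a single side of A. *)
Lemma part_le_or A C i j :
  sealed A C ->
  H i :&: A = H j :&: A -> part_le C i j \/ part_le (~: C) i j.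
Proof.
move=> clC tr; have [?|/subsetPn[x /setIP[xi xC] xj]] := boolP (part_le C i j); [by left | right].
(* The difference is connected and, the traces being equal, misses [A]; its point in [C] forces all
   of it into [C]. *)
have sC : H i :\: H j \subset C.
  apply: (connected_avoiding (x := x) clC) => //; last by rewrite inE xj.
  rewrite -setI_eq0; apply/eqP/setP=> y; rewrite !inE.
  have /setP/(_ y) := tr; rewrite !inE.
  by case: (y \in A); rewrite ?andbF // !andbT => ->; case: (y \in H j).
apply/subsetP=> y; rewrite !inE => /andP[yi yC]; apply: contraR yC => yj.
by apply: (subsetP sC); rewrite inE yj.
Qed.

(* [W] is the set of members that the parent bag wants in the root bag; the top
   member of a trace class must dominate those inside C. *)
Definition top A C F W S g :=
  [/\ g \in F, H g :&: A = S,
      forall i, i \in F -> H i :&: A = S -> part_le C g i -> part_le C i g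
    & forall w, w \in W -> H w :&: A = S -> part_le C w g].

Lemma part_le_eqP C i j :
  part_le C i j -> part_le C j i -> H i :&: C = H j :&: C.
Proof.
move=> ij ji; apply/eqP; rewrite eqEsubset.
by apply/andP; split; rewrite subsetI subsetIr andbT.
Qed.

Lemma part_lexx C i : part_le C i i.
Proof. exact: subsetIl. Qed.

Lemma part_le_trans C i j k : part_le C i j -> part_le C j k -> part_le C i k.
Proof.
move=> ij; apply: subset_trans; rewrite subsetI subsetIr andbT; exact: ij.
Qed.

Lemma part_leS C D i j : C \subset D -> part_le D i j -> part_le C i j.
Proof. by move=> CD; apply: subset_trans; rewrite setIS. Qed.

Lemma part_le_card C i j : part_le C i j -> #|H j :&: C| <= #|H i :&: C| -> part_le C j i.
Proof.
rewrite /part_le => ij le; suff <- : H i :&: C = H j :&: C by exact: subsetIl.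
by apply/eqP; rewrite eqEcard le andbT subsetI ij subsetIr.
Qed.

(** Members of one trace class incomparable within [C] coincide outside [C], which distinct members
    of [W] never do. So the largest one of [W] in the class dominates the others of [W] there, and a
    maximal member above it is a top. *)
Lemma top_exists A C F W i0 :
  sealed A C ->
  {in W &, forall w w', H w :&: ~: C = H w' :&: ~: C -> w = w'} ->
  W \subset F -> i0 \in F -> exists g, top A C F W (H i0 :&: A) g.
Proof.
move=> clC injW /subsetP WF i0F; set S := H i0 :&: A.
have [i1 [i1F i1S i1W]] : exists i1, [/\ i1 \in F, H i1 :&: A = S &
    forall w, w \in W -> H w :&: A = S -> part_le C w i1].
  have [/existsP[w0 w0P]|none] := boolP [exists w, (w \in W) && (H w :&: A == S)]; last first.
    exists i0; split=> // w wW wS; case/negP: none; apply/existsP; exists w.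
    by rewrite wW wS eqxx.
  have := @arg_maxnP _ w0 (fun w => (w \in W) && (H w :&: A == S)) (fun w => #|H w :&: C|) w0P.
  case=> w1 /andP[w1W /eqP w1S] w1max.
  exists w1; split=> // [|w wW wS]; first exact: WF.
  have wle : #|H w :&: C| <= #|H w1 :&: C| by apply: w1max; rewrite wW wS eqxx.
  have [//|le1] := part_le_or clC (etrans wS (esym w1S)).
  have [le2|le2] := part_le_or clC (etrans w1S (esym wS)); first exact: part_le_card wle.
  by rewrite (injW _ _ wW w1W (part_le_eqP le1 le2)); apply: subsetIl.
have P1 : [&& i1 \in F, H i1 :&: A == S & part_le C i1 i1].
  by rewrite i1F i1S eqxx /part_le subsetIl.
have := @arg_maxnP _ i1 (fun i => [&& i \in F, H i :&: A == S & part_le C i1 i])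
   (fun i => #|H i :&: C|) P1.
case=> g /and3P[gF /eqP gS i1g] gmax; exists g; split=> // [i iF iS gi|w wW wS].
  apply: (part_le_card gi); apply: gmax.
  by rewrite iF iS eqxx (part_le_trans i1g gi).
exact: part_le_trans (i1W w wW wS) i1g.
Qed.

Lemma top_eq A C F W S g i : top A C F W S g -> i \in F -> H i :&: A = S ->
  H i :&: C = H g :&: C -> top A C F W S i.
Proof.
move=> [gF gS gmax gW] iF iS eC; have gi : part_le C g i by rewrite /part_le -eC subsetIl.
split=> // [j jF jS ij|w wW wS]; last exact: part_le_trans (gW w wW wS) gi.
by apply: (part_le_trans _ gi); apply: gmax => //; apply: part_le_trans gi ij.
Qed.

(** By maximality [g] is not below [i] within [C] either, so [part_le_or] gives both inclusions
    outside [C]. *)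
Lemma top_incomparable A C F W S g i :
  sealed A C ->
  top A C F W S g -> i \in F -> H i :&: A = S -> ~~ part_le C i g ->
  H i :&: ~: C = H g :&: ~: C.
Proof.
move=> clC [gF gS gmax _] iF iS nig.
have [ig|ig] := part_le_or clC (etrans iS (esym gS)); first by rewrite ig in nig.
have [gi|gi] := part_le_or clC (etrans gS (esym iS)).
  by rewrite gmax in nig.
exact: part_le_eqP.
Qed.

(** If one domination fails, the two tops coincide outside one side, hence on the other side, and a
    single member is a top for both. *)
Lemma top_pair A C1 C2 F W i0 :
  sealed A C1 ->
  sealed A C2 ->
  [disjoint C1 & C2] ->
  {in W &, forall w w', H w :&: ~: C1 = H w' :&: ~: C1 -> w = w'} ->
  {in W &, forall w w', H w :&: ~: C2 = H w' :&: ~: C2 -> w = w'} ->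
  W \subset F -> i0 \in F -> exists g1 g2,
  [/\ top A C1 F W (H i0 :&: A) g1, top A C2 F W (H i0 :&: A) g2,
      part_le C1 g2 g1 & part_le C2 g1 g2].
Proof.
move=> cl1 cl2 d12 inj1 inj2 WF i0F.
have [g1 t1] := top_exists cl1 inj1 WF i0F.
have [g2 t2] := top_exists cl2 inj2 WF i0F.
have eqC C D i j : [disjoint C & D] -> H i :&: ~: C = H j :&: ~: C -> H i :&: D = H j :&: D.
  rewrite disjoint_sym disjoints_subset => /setIidPr DC.
  by move=> eq; rewrite -DC !setIA eq.
have [g1F g1S _ _] := t1; have [g2F g2S _ _] := t2.
have [le1|n1] := boolP (part_le C1 g2 g1); last first.
  have eq := top_incomparable cl1 t1 g2F g2S n1.
  exists g1, g1; rewrite /part_le !subsetIl; split=> //.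
  by apply: top_eq t2 g1F g1S _; apply: eqC d12 (esym eq).
have [le2|n2] := boolP (part_le C2 g1 g2); first by exists g1, g2.
have eq := top_incomparable cl2 t2 g1F g1S n2.
exists g2, g2; rewrite /part_le !subsetIl; split=> //.
by apply: top_eq t1 g2F g2S _; apply: eqC (esym eq); rewrite disjoint_sym.
Qed.

Lemma top_pair_choice A C1 C2 F W :
  sealed A C1 ->
  sealed A C2 ->
  [disjoint C1 & C2] ->
  {in W &, forall w w', H w :&: ~: C1 = H w' :&: ~: C1 -> w = w'} ->
  {in W &, forall w w', H w :&: ~: C2 = H w' :&: ~: C2 -> w = w'} ->
  W \subset F -> exists g1 g2 : I -> I,
  (forall i, i \in F ->
    [/\ top A C1 F W (H i :&: A) (g1 i), top A C2 F W (H i :&: A) (g2 i),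
        part_le C1 (g2 i) (g1 i) & part_le C2 (g1 i) (g2 i)]) /\
  {in F &, forall i j, H i :&: A = H j :&: A -> g1 i = g1 j /\ g2 i = g2 j}.
Proof.
move=> cl1 cl2 d12 inj1 inj2 WF.
pose topb C S g := [&& g \in F, H g :&: A == S,
   [forall (i | i \in F), (H i :&: A == S) ==> part_le C g i ==> part_le C i g]
   & [forall (w | w \in W), (H w :&: A == S) ==> part_le C w g]].
have topP C S g : reflect (top A C F W S g) (topb C S g).
  apply: (iffP and4P) => [[gF /eqP gS /forall_inP mx /forall_inP up]|[gF gS mx up]]; split=> //.
  - by move=> i iF /eqP iS gi; have := mx i iF; rewrite iS gi.
  - by move=> w wW /eqP wS; have := up w wW; rewrite wS.
  - exact/eqP.
  - by apply/forall_inP=> i iF; apply/implyP=> /eqP iS; apply/implyP; apply: mx.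
  - by apply/forall_inP=> w wW; apply/implyP=> /eqP wS; apply: up.
pose ok S (p : I * I) := [&& topb C1 S p.1, topb C2 S p.2,
   part_le C1 p.2 p.1 & part_le C2 p.1 p.2].
(* The pick sees [i] only through its trace, so equal traces give equal pairs; the default is
   reached only outside [F]. *)
pose g i := if [pick p | ok (H i :&: A) p] is Some p then p else (i, i).
have gok i : i \in F -> ok (H i :&: A) (g i).
  move=> iF; rewrite /g; case: pickP => // none.
  have [g1 [g2 [t1 t2 le1 le2]]] := top_pair (A := A) cl1 cl2 d12 inj1 inj2 WF iF.
  by have /negP[] := none (g1, g2); apply/and4P; split=> //; apply/topP.
exists (fun i => (g i).1), (fun i => (g i).2); split.
  by move=> i /gok/and4P[/topP t1 /topP t2 le1 le2].
move=> i j iF jF eq; suff -> : g i = g j by [].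
have := gok j jF; rewrite /g eq.
by case: pickP => // none okj; have := none (j, j); rewrite okj.
Qed.

(** * Splitting the family along the separator *)

Definition crossing A i := H i :&: A != set0.

(** The members passed on to the problem for [C]. The representatives [g i] go along as the
    interface to the root; empty members stay at the root. *)
Definition side_members A C F (g : I -> I) := [set i in F |
  if crossing A i then (i == g i) || ~~ part_le C i (g i)
  else (H i != set0) && (H i \subset C)].

Definition core_members A C1 C2 F (g1 g2 : I -> I) := [set i in F |
  if crossing A i then part_le C1 i (g1 i) && part_le C2 i (g2 i)
  else (H i == set0) || ~~ (H i \subset C1) && ~~ (H i \subset C2)].

Definition hubs A F (g : I -> I) := [set g i | i in F & crossing A i].

(** Every member shares a bag with all of [R], so a representative containing [l] is adjacent to all
    members containing [l]. *)
Lemma star_support k F R P : R \subset F -> #|R| <= k ->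
  (forall l i, l \in P -> i \in above F l -> exists2 j, j \in R & j \in above F l) ->
  bag_support k F R P R [seq i |: R | i <- enum F].
Proof.
move=> RF Rk rep; split=> //; first exact: rip_star.
- move=> b; rewrite in_cons => /orP[/eqP->|/mapP[i _ ->]]; first exact: leqW.
  by rewrite cardsU1 (leq_trans (leq_add (leq_b1 _) Rk)).
- move=> i; apply/idP/idP => [/hasP[b]|iF].
    rewrite in_cons => /orP[/eqP->|/mapP[j]]; first exact: (subsetP RF).
    rewrite mem_enum => jF -> /setU1P[->//|]; exact: (subsetP RF).
  apply/hasP; exists (i |: R); last by rewrite setU11.
  by rewrite in_cons; apply/orP; right; apply/mapP; exists i; rewrite ?mem_enum.
- move=> l lP; apply: connected_in_hub; first exact: cobag_sym.
  move=> x y xl yl; have [j jR jl] := rep l x lP xl.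
  by exists j; apply: connect_induced1 => //; apply: cobag_star => //;
    [move: xl | move: yl]; rewrite inE => /andP[].
Qed.

Section Side.
Variables (A C : {set T}) (F W : {set I}) (g : I -> I).
Hypothesis closedC : sealed A C.
Hypothesis g_top : forall i, i \in F -> top A C F W (H i :&: A) (g i).
Hypothesis g_tr : {in F &, forall i j, H i :&: A = H j :&: A -> g i = g j}.

Lemma crossing_top i : i \in F -> crossing A i = crossing A (g i).
Proof. by move=> /g_top[_ e1 _ _]; rewrite /crossing e1. Qed.

Lemma top_idem i : i \in F -> g (g i) = g i.
Proof. by move=> iF; have [giF gtr _ _] := g_top iF; apply: g_tr. Qed.

Lemma hubs_trace_inj i j : i \in hubs A F g -> j \in hubs A F g ->
  H i :&: A = H j :&: A -> i = j.
Proof.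
case/imsetP=> i'; rewrite inE => /andP[iF _] -> /imsetP[j']; rewrite inE => /andP[jF _] ->.
have [_ -> _ _] := g_top iF; have [_ -> _ _] := g_top jF; exact: g_tr.
Qed.

Lemma card_hubs : #|hubs A F g| <= 2 ^ #|A|.
Proof.
rewrite -card_powerset -(card_in_imset (f := fun i => H i :&: A)); last first.
  by move=> i j; apply: hubs_trace_inj.
by apply/subset_leq_card/subsetP=> _ /imsetP[i _ ->]; rewrite inE subsetIr.
Qed.

Lemma hubs_side : hubs A F g \subset side_members A C F g.
Proof.
apply/subsetP=> x /imsetP[i]; rewrite inE => /andP[iF ci] ->.
have [giF _ _ _] := g_top iF.
by rewrite inE giF -crossing_top // ci top_idem // eqxx.
Qed.

(* Members that stick out of the top one towards C agree with it elsewhere. *)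
Lemma side_link (Q : rel I) l i :
  (forall j, j \in F -> crossing A j ->
     connected_in Q (above (side_members A C F g) (H (g j) :&: ~: C))) ->
  i \in side_members A C F g -> crossing A i -> l \subset H i -> l \subset ~: C ->
  connect (induced Q (above F l)) i (g i) /\ g i \in above F l.
Proof.
move=> con iS ci li lC; have := iS; rewrite inE ci => /andP[iF /orP[/eqP<-|nle]].
  by rewrite connect0 inE iF.
have [giF gtr _ _] := g_top iF.
have eqo := top_incomparable closedC (g_top iF) iF (erefl _) nle.
have giS : g i \in side_members A C F g.
  by apply: (subsetP hubs_side); apply/imsetP; exists i; rewrite // inE iF.
have lo : l \subset H (g i) :&: ~: C by rewrite -eqo subsetI li.
split; last by rewrite inE giF (subset_trans lo) ?subsetIl.
(* The path joins members containing the whole outer part of [g i], and this part contains [l]. *)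
apply: (connect_inducedS (r := Q) (D := above (side_members A C F g) (H (g i) :&: ~: C))) => //.
  apply/subsetP=> j; rewrite !inE => /andP[/andP[-> _] h]; exact: subset_trans lo h.
by apply: con => //; apply/setIdP; split=> //; [rewrite -eqo|]; apply: subsetIl.
Qed.

End Side.

Lemma noncrossing_sub A C i v : sealed A C ->
  ~~ crossing A i -> v \in H i -> v \in C -> H i \subset C.
Proof.
move=> clC; rewrite negbK setI_eq0 => dA vi vC.
exact: connected_avoiding clC (@H_conn i) dA vi vC.
Qed.

Section Linking.
Variables (A C D : {set T}) (F W K : {set I}) (g h : I -> I) (Q : rel I) (v : T).
Hypothesis closedC : sealed A C.
Hypothesis closedD : sealed A D.
Hypothesis disjCD : [disjoint C & D].
Hypothesis g_top : forall i, i \in F -> top A C F W (H i :&: A) (g i).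
Hypothesis h_top : forall i, i \in F -> top A D F W (H i :&: A) (h i).
Hypothesis g_tr : {in F &, forall i j, H i :&: A = H j :&: A -> g i = g j}.
Hypothesis h_tr : {in F &, forall i j, H i :&: A = H j :&: A -> h i = h j}.
Hypothesis Q_sym : symmetric Q.
Hypothesis Q_link : forall j, j \in F -> crossing A j ->
  connected_in Q (above (side_members A D F h) (H (h j) :&: ~: D)).
Hypothesis F_cases : forall i, i \in F ->
  [\/ i \in K, i \in side_members A C F g | i \in side_members A D F h].
Hypothesis KF : K \subset F.
Hypothesis hK : hubs A F h \subset K.
Hypothesis K_le : forall i, i \in K -> crossing A i -> part_le C i (g i) /\ Q i (g i).
Hypothesis K_out : forall i, i \in K -> ~~ crossing A i -> H i != set0 -> ~~ (H i \subset C).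
Hypothesis vC : v \in C.
Hypothesis Q_side : connected_in Q (above (side_members A C F g) [set v]).

(** Every member containing [v] is led to the side of [C], where [Q_side] applies: a core member
    goes to its dominating [g x], and a member on the side of [D] first goes to [h x], which agrees
    with it on [C] and is a core member. *)
Lemma side_vertex_connected : connected_in Q (above F [set v]).
Proof.
have core_link x : x \in K -> v \in H x -> exists2 z,
    z \in above (side_members A C F g) [set v] & connect (induced Q (above F [set v])) x z.
  move=> xK vx; have xF := subsetP KF x xK.
  have cx : crossing A x.
    apply: contraT => ncx; have := K_out xK ncx.
    rewrite (noncrossing_sub closedC ncx vx vC) /= => -> //.
    by apply/set0Pn; exists v.
  have [lex Qx] := K_le xK cx; have [gF _ _ _] := g_top xF.
  have vg : v \in H (g x) by apply: (subsetP lex); rewrite inE vx.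
  exists (g x); last by apply: connect_induced1; rewrite ?inE ?sub1set ?xF ?gF.
  apply/setIdP; rewrite sub1set; split=> //.
  by apply: (subsetP (hubs_side g_top g_tr)); apply: imset_f; rewrite inE xF.
have link x : x \in above F [set v] -> exists2 z,
    z \in above (side_members A C F g) [set v] & connect (induced Q (above F [set v])) x z.
  move=> xab; have := xab; rewrite inE sub1set => /andP[xF vx].
  case: (F_cases xF) => [xK|xC|xD]; first exact: core_link.
    by exists x; [apply/setIdP; rewrite sub1set | apply: connect0].
  have cx : crossing A x.
    move: xD; rewrite inE xF /=; case: ifP => // _ /andP[_ /subsetP/(_ v vx) vD].
    by have := disjointFr disjCD vC; rewrite vD.
  have [||xh hab] := side_link (l := [set v]) closedD h_top h_tr Q_link xD cx; rewrite ?sub1set //.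
    by rewrite inE (disjointFr disjCD vC).
  have [||z zC hz] := core_link (h x).
  - by apply: (subsetP hK); apply: imset_f; rewrite inE xF.
  - by move: hab; rewrite inE sub1set => /andP[].
  by exists z => //; apply: connect_trans xh hz.
apply: connected_in_hub => // x y xab yab.
have [a aC xa] := link x xab; have [b bC yb] := link y yab.
exists a => //; apply: connect_trans yb _.
apply: (connect_inducedS (r := Q)) (Q_side bC aC) => //.
by apply/subsetP=> j; rewrite !inE => /andP[/andP[-> _] ->].
Qed.

End Linking.

(** * Combining the root bag with the two sides *)

Section Node.

Variables (A C1 C2 : {set T}) (F W : {set I}) (g1 g2 : I -> I).
Hypothesis closed1 : sealed A C1.
Hypothesis closed2 : sealed A C2.
Hypothesis disj12 : [disjoint C1 & C2].
Hypothesis g_top : forall i, i \in F ->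
    [/\ top A C1 F W (H i :&: A) (g1 i), top A C2 F W (H i :&: A) (g2 i),
        part_le C1 (g2 i) (g1 i) & part_le C2 (g1 i) (g2 i)].
Hypothesis g_tr :
  {in F &, forall i j, H i :&: A = H j :&: A -> g1 i = g1 j /\ g2 i = g2 j}.

Let F1 := side_members A C1 F g1.
Let F2 := side_members A C2 F g2.
Let F0 := core_members A C1 C2 F g1 g2.

Let top1 i : i \in F -> top A C1 F W (H i :&: A) (g1 i).
Proof. by case/g_top. Qed.
Let top2 i : i \in F -> top A C2 F W (H i :&: A) (g2 i).
Proof. by case/g_top. Qed.
Let tr1 : {in F &, forall i j, H i :&: A = H j :&: A -> g1 i = g1 j}.
Proof. by move=> i j iF jF /(g_tr iF jF)[]. Qed.
Let tr2 : {in F &, forall i j, H i :&: A = H j :&: A -> g2 i = g2 j}.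
Proof. by move=> i j iF jF /(g_tr iF jF)[]. Qed.

Lemma member_cases i : i \in F -> [\/ i \in F0, i \in F1 | i \in F2].
Proof.
move=> iF; rewrite /F0 /F1 /F2 !inE iF /=.
case: (crossing A i).
  case: (part_le C1 i _); last by constructor 2; rewrite orbT.
  case: (part_le C2 i _); last by constructor 3; rewrite orbT.
  by constructor 1.
have [_|_] := eqVneq (H i) set0; first by constructor 1.
have [_|_] := boolP (H i \subset C1); first by constructor 2.
have [_|_] := boolP (H i \subset C2); first by constructor 3.
by constructor 1.
Qed.

(** Here the mutual domination of the two tops is used: [g1 i] is dominated by [g2 i] within
    [C2]. *)
Lemma hubs1_core : hubs A F g1 \subset F0.
Proof.
apply/subsetP=> x /imsetP[i]; rewrite inE => /andP[iF ci] ->.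
have [[giF gS _ _] _ _ le2] := g_top iF.
rewrite inE giF -(crossing_top top1) // ci (top_idem top1 tr1) //.
by rewrite part_lexx (tr2 giF iF).
Qed.

Lemma hubs2_core : hubs A F g2 \subset F0.
Proof.
apply/subsetP=> x /imsetP[i]; rewrite inE => /andP[iF ci] ->.
have [_ [giF gS _ _] le1 _] := g_top iF.
rewrite inE giF -(crossing_top top2) // ci (top_idem top2 tr2) //.
by rewrite part_lexx (tr1 giF iF) // le1.
Qed.

(** Crossing members of [W] are dominated by both tops by their choice; the others have a point in
    [D], outside both sides. *)
Lemma W_core (D : {set T}) : D \subset ~: C1 -> D \subset ~: C2 ->
  (forall w, w \in W -> H w :&: D != set0) -> W \subset F -> W \subset F0.
Proof.
move=> D1 D2 WD /subsetP WF; apply/subsetP=> w wW; have wF := WF w wW.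
have [[_ _ _ up1] [_ _ _ up2] _ _] := g_top wF.
rewrite inE wF; case: (crossing A w); first by rewrite up1 ?up2.
have /set0Pn[x /setIP[xw xD]] := WD w wW; apply/orP; right.
apply/andP; split; apply/subsetPn; exists x => //.
  by have := subsetP D1 x xD; rewrite inE.
by have := subsetP D2 x xD; rewrite inE.
Qed.

Lemma core_side1 i : i \in F0 -> i \in F1 -> i \in hubs A F g1.
Proof.
rewrite !inE => /andP[iF]; rewrite iF /=; case: ifP => [ci /andP[-> _]|_].
  by rewrite orbF => /eqP->; apply: imset_f; rewrite inE iF.
by case: (H i == set0) => //= /andP[/negbTE->].
Qed.

Lemma core_side2 i : i \in F0 -> i \in F2 -> i \in hubs A F g2.
Proof.
rewrite !inE => /andP[iF]; rewrite iF /=; case: ifP => [ci /andP[_ ->]|_].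
  by rewrite orbF => /eqP->; apply: imset_f; rewrite inE iF.
by case: (H i == set0) => //= /andP[_ /negbTE->].
Qed.

(** A member not dominated by [g1 i] equals [g1 i] on [C2], so it is dominated there and must be
    [g2 i]; but [g2 i] is dominated by [g1 i] within [C1]. *)
Lemma sides_meet i : i \in F1 -> i \in F2 -> i \in hubs A F g2.
Proof.
move=> i1 i2; apply: core_side2 => //.
have iF : i \in F by move: i1; rewrite inE => /andP[].
have [t1 t2 le1 le2] := g_top iF.
move: i1 i2; rewrite !inE iF /=; case: ifP => [ci|_]; last first.
  case/andP=> /set0Pn[x xi] s1 /andP[_ s2].
  by have := disjointFr disj12 (subsetP s1 x xi); rewrite (subsetP s2 x xi).
case/orP=> [/eqP e1 _|n1 h2].
  by rewrite -e1 part_lexx /= {1}e1.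
have eq1 := top_incomparable closed1 t1 iF (erefl _) n1.
have li2 : part_le C2 i (g2 i).
  apply: part_le_trans le2; apply: (part_leS (D := ~: C1)).
    by rewrite -disjoints_subset disjoint_sym.
  by rewrite /part_le eq1 subsetIl.
move: h2; rewrite li2 orbF => /eqP e2; move: n1; rewrite {1}e2 le1 //.
Qed.

(** Both side solutions are hung on the root bag [R]. Any member shared between pieces is a hub,
    hence lies in [R] and in the first bag of the side solution. *)
Lemma node_support k P R r1 s1 r2 s2 :
  R \subset F0 -> hubs A F g1 :|: hubs A F g2 :|: W \subset R -> #|R| <= k ->
  (forall l i, l \in P -> i \in above F0 l -> exists2 j, j \in R & j \in above F0 l) ->
  (forall l, l \in P -> [/\ l != set0, l \subset ~: C1 & l \subset ~: C2]) ->
  bag_support k F1 (hubs A F g1)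
    ([set H i :&: ~: C1 | i in hubs A F g1] :|: [set [set v] | v in C1]) r1 s1 ->
  bag_support k F2 (hubs A F g2)
    ([set H i :&: ~: C2 | i in hubs A F g2] :|: [set [set v] | v in C2]) r2 s2 ->
  bag_support k F W (P :|: [set [set v] | v in C1] :|: [set [set v] | v in C2])
    R ([seq i |: R | i <- enum F0] ++ (r1 :: s1) ++ (r2 :: s2)).
Proof.
rewrite !subUset => RF0 /andP[/andP[h1R h2R] WR] Rk rep Pout
  [rip1 W1 bnd1 cov1 con1] [rip2 W2 bnd2 cov2 con2].
have [rip0 _ bnd0 cov0 _] := star_support RF0 Rk rep.
set s0 := [seq i |: R | i <- enum F0] in rip0 bnd0 cov0 *.
set s := s0 ++ _; have es : R :: s = ((R :: s0) ++ (r1 :: s1)) ++ (r2 :: s2) by rewrite -catA.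
have sub0 : F0 \subset F by apply/subsetP=> i; rewrite inE => /andP[].
have sub1 : F1 \subset F by apply/subsetP=> i; rewrite inE => /andP[].
have sub2 : F2 \subset F by apply/subsetP=> i; rewrite inE => /andP[].
set Q := cobag (R :: s).
have Q0 i j : i \in F0 -> j \in R -> Q i j.
  by move=> iF0 jR; rewrite /Q es !cobag_cat /s0 cobag_star.
have Q1 : subrel (cobag (r1 :: s1)) Q.
  by move=> i j ij; rewrite /Q es !cobag_cat ij orbT.
have Q2 : subrel (cobag (r2 :: s2)) Q.
  by move=> i j ij; rewrite /Q es !cobag_cat ij orbT.
have Qs : symmetric Q by apply: cobag_sym.
have con (q : rel I) (D : {set I}) : subrel q Q -> connected_in q D -> connected_in Q D.
  by move=> qQ cD x y xD yD; apply: (connect_inducedS qQ (subxx _)); apply: cD.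
have hub1 i : i \in F -> crossing A i -> g1 i \in hubs A F g1.
  by move=> iF ci; apply: imset_f; rewrite inE iF.
have hub2 i : i \in F -> crossing A i -> g2 i \in hubs A F g2.
  by move=> iF ci; apply: imset_f; rewrite inE iF.
have link1 j : j \in F -> crossing A j ->
    connected_in Q (above F1 (H (g1 j) :&: ~: C1)).
  move=> jF cj; apply: con Q1 (con1 _ _); rewrite inE; apply/orP; left.
  by apply/imsetP; exists (g1 j); rewrite ?hub1.
have link2 j : j \in F -> crossing A j ->
    connected_in Q (above F2 (H (g2 j) :&: ~: C2)).
  move=> jF cj; apply: con Q2 (con2 _ _); rewrite inE; apply/orP; left.
  by apply/imsetP; exists (g2 j); rewrite ?hub2.
have coreP i : i \in F0 -> crossing A i -> [/\ part_le C1 i (g1 i), part_le C2 i (g2 i),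
    Q i (g1 i) & Q i (g2 i)].
  move=> iF0 ci; have iF := subsetP sub0 i iF0.
  have := iF0; rewrite inE ci => /and3P[_ -> ->].
  by split=> //; apply: Q0 => //; [apply/(subsetP h1R)/hub1 | apply/(subsetP h2R)/hub2].
have coreN i : i \in F0 -> ~~ crossing A i -> H i != set0 ->
    ~~ (H i \subset C1) && ~~ (H i \subset C2).
  by rewrite inE => /andP[_] + /negbTE ci; rewrite ci => /orP[->|].
split=> //.
- rewrite es; apply: (@rip_cat _ _ _ R) => //.
  + apply: (@rip_cat _ _ _ R) => //; first exact: mem_head.
    move=> i; rewrite cov0 cov1 => i0 i1; have ih := core_side1 i0 i1.
    by rewrite (subsetP h1R) // (subsetP W1).
  + by rewrite mem_cat mem_head.
  + move=> i; rewrite has_cat cov0 cov1 cov2 => i01 i2.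
    have ih : i \in hubs A F g2 by case/orP: i01 => ?; [apply: core_side2 | apply: sides_meet].
    by rewrite (subsetP h2R) // (subsetP W2).
- move=> b; rewrite es !mem_cat => /orP[/orP[]|]; [exact: bnd0|exact: bnd1|exact: bnd2].
- move=> i; rewrite es !has_cat cov0 cov1 cov2; apply/idP/idP.
    by case/orP=> [/orP[]|]; apply: subsetP.
  by case/member_cases=> ->; rewrite ?orbT.
move=> l; rewrite !inE => /orP[/orP[lP|/imsetP[v vC ->]]|/imsetP[v vC ->]].
- have [l0 l1 l2] := Pout l lP; have [v vl] := set0Pn _ l0.
  have out C i : l \subset ~: C -> H i \subset C -> l \subset H i -> false.
    by move=> lC iC li; have := subsetP lC v vl; rewrite inE (subsetP iC) // (subsetP li).
  (* A side member containing [l] must cross [A], since [l] is nonempty and avoids both sides; it is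
     then linked to its hub at the root. *)
  have toF0 x : x \in above F l -> exists2 z,
      z \in above F0 l & connect (induced Q (above F l)) x z.
    move=> xab; have := xab; rewrite inE => /andP[xF lx].
    case: (member_cases xF) => [x0|x1|x2].
    + by exists x; [apply/setIdP | apply: connect0].
    + have cx : crossing A x.
        by have := x1; rewrite inE xF /=; case: ifP => // _ /andP[_ /(out _ _ l1)/(_ lx)].
      have [xg gab] := side_link closed1 top1 tr1 link1 x1 cx lx l1.
      exists (g1 x) => //; move: gab; rewrite inE => /andP[_ lg]; apply/setIdP; split=> //.
      by apply: (subsetP RF0); apply: (subsetP h1R); apply: hub1.
    + have cx : crossing A x.
        by have := x2; rewrite inE xF /=; case: ifP => // _ /andP[_ /(out _ _ l2)/(_ lx)].
      have [xg gab] := side_link closed2 top2 tr2 link2 x2 cx lx l2.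
      exists (g2 x) => //; move: gab; rewrite inE => /andP[_ lg]; apply/setIdP; split=> //.
      by apply: (subsetP RF0); apply: (subsetP h2R); apply: hub2.
  have sab : above F0 l \subset above F l.
    by apply/subsetP=> x /setIdP[x0 lx]; apply/setIdP; rewrite (subsetP sub0).
  apply: connected_in_hub => // x y xab yab.
  have [a a0 xa] := toF0 x xab; have [b b0 yb] := toF0 y yab.
  have [j jR jl] := rep l a lP a0.
  exists j; [apply: connect_trans xa _ | apply: connect_trans yb _];
    apply: connect_induced1; rewrite ?(subsetP sab) // Q0 //.
    by case/setIdP: a0.
  by case/setIdP: b0.
- apply: (@side_vertex_connected A C1 C2 F W F0 g1 g2) => //.
  + exact: member_cases.
  + exact: subset_trans h2R RF0.
  + by move=> i i0 ci; have [] := coreP i i0 ci.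
  + by move=> i i0 ci in0; case/andP: (coreN i i0 ci in0).
  + by apply: con Q1 (con1 _ _); rewrite inE; apply/orP; right; apply: imset_f.
- apply: (@side_vertex_connected A C2 C1 F W F0 g2 g1) => //.
  + by rewrite disjoint_sym.
  + by move=> i iF; case: (member_cases iF) => h; [constructor 1|constructor 3|constructor 2].
  + exact: subset_trans h1R RF0.
  + by move=> i i0 ci; have [] := coreP i i0 ci.
  + by move=> i i0 ci in0; case/andP: (coreN i i0 ci in0).
  + by apply: con Q2 (con2 _ _); rewrite inE; apply/orP; right; apply: imset_f.
Qed.

End Node.

(** * Counting and induction over the decomposition *)

Lemma bag_supportS k F W P P' r s :
  P' \subset P -> bag_support k F W P r s -> bag_support k F W P' r s.
Proof. by move=> /subsetP PP [? ? ? ? con]; split=> // l /PP; apply: con. Qed.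

Lemma cardsU_leq (J : finType) (X Y : {set J}) m n :
  #|X| <= m -> #|Y| <= n -> #|X :|: Y| <= m + n.
Proof. by move=> Xm Yn; apply: leq_trans (leq_card_setU X Y).1 (leq_add Xm Yn). Qed.

(** With n = 2^(t+1), the left side is at most 5 n, and 5 <= 2^3 <= n^3. *)
Lemma width_bound t : 4 * 2 ^ t.+1 + t.+1 <= 2 ^ (4 * t.+1).
Proof.
have n2 : 2 <= 2 ^ t.+1 by rewrite -{1}(expn1 2) leq_exp2l.
have tn : t.+1 <= 2 ^ t.+1 by apply/ltnW/ltn_expl.
rewrite (mulnC 4 t.+1) expnM; move: (2 ^ t.+1) n2 tn => n n2 tn.
have n5 : 4 * n + t.+1 <= 4 * n + n by rewrite leq_add2l.
apply: (leq_trans n5); rewrite addnC -mulSn.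
rewrite expnSr leq_mul2r; apply/orP; right.
by apply: (@leq_trans (2 ^ 3)) => //; rewrite leq_exp2r.
Qed.

(* The interface with the part of G outside V: members of W link to it, and each
   set in P is an outer part whose containing members have to be linked. *)
Definition supportable t V A := forall F W P,
  W \subset F -> #|W| <= 2 ^ t.+1 -> #|P| <= 2 ^ t.+1 ->
  (forall l, l \in P -> (l != set0) && (l \subset ~: V :|: A)) ->
  (forall w, w \in W -> H w :&: (~: V :|: A) != set0) ->
  {in W &, forall w w', H w :&: (~: V :|: A) = H w' :&: (~: V :|: A) -> w = w'} ->
  exists r s, bag_support (2 ^ (4 * t.+1)) F W (P :|: [set [set v] | v in V]) r s.

(** The hubs serve as [W] and their outer parts as [P]. All hubs meet [A] and are told apart by
    their traces on it, and [A] lies in the outer region of the subproblem. *)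
Lemma side_support t A V1 A1 F W g :
  #|A| <= t.+1 -> A :&: V1 \subset A1 ->
  (forall i, i \in F -> top A (V1 :\: A) F W (H i :&: A) (g i)) ->
  {in F &, forall i j, H i :&: A = H j :&: A -> g i = g j} ->
  supportable t V1 A1 ->
  exists r s, bag_support (2 ^ (4 * t.+1)) (side_members A (V1 :\: A) F g) (hubs A F g)
    ([set H i :&: ~: (V1 :\: A) | i in hubs A F g] :|: [set [set v] | v in V1 :\: A]) r s.
Proof.
move=> Ak sA tp tg IH; have pw : 2 ^ #|A| <= 2 ^ t.+1 by rewrite leq_exp2l.
 set C1 := V1 :\: A.
have AU : A \subset ~: V1 :|: A1.
  apply/subsetP=> v vA; rewrite !inE; case: (boolP (v \in V1)) => //= vV.
  by apply: (subsetP sA); rewrite inE vA.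
have CU : ~: C1 \subset ~: V1 :|: A1.
  apply/subsetP=> v; rewrite 2!inE negb_and negbK => /orP[/(subsetP AU)//|nv].
  by rewrite !inE nv.
have AC : A \subset ~: C1 by apply/subsetP=> v vA; rewrite !inE vA.
have hubX i : i \in hubs A F g -> crossing A i.
  by case/imsetP=> j; rewrite inE => /andP[jF cj] ->; rewrite -(crossing_top tp).
have ch : #|hubs A F g| <= 2 ^ t.+1 by apply: leq_trans (card_hubs tp tg) pw.
have [||||||r [s sup]] := IH (side_members A C1 F g) (hubs A F g)
  [set H i :&: ~: C1 | i in hubs A F g].
- exact: hubs_side tp tg.
- exact: ch.
- exact: leq_trans (leq_imset_card _ _) ch.
- move=> l /imsetP[i /hubX/set0Pn[x /setIP[xi xA]] ->]; apply/andP; split.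
    by apply/set0Pn; exists x; rewrite inE xi (subsetP AC).
  by apply: subset_trans CU; apply: subsetIr.
- move=> w /hubX/set0Pn[x /setIP[xi xA]]; apply/set0Pn; exists x.
  by rewrite inE xi (subsetP AU).
- move=> w w' wh wh' eq; apply: (hubs_trace_inj tp tg) => //.
  by rewrite -(setIidPr AU) !setIA eq.
exists r, s; apply: bag_supportS sup; apply: setUS; apply: imsetS; exact: subsetDl.
Qed.

(** At a leaf one star suffices; at a node a star on the core members is glued to the solutions of
    the two sides. *)
Lemma rooted_dec_supportable t V A : rooted_dec e t V A -> supportable t V A.
Proof.
(* Three n for the two hub sets and [W]; n + m for representatives of [P] and of the vertices of
   [A]. *)
have four n m : 4 * n + m = (n + n + n) + (n + m) by rewrite !mulSn addn0 -!addnA.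
elim=> {V A} [A Ak|A V1 A1 V2 A2 Ak d1 IH1 d2 IH2 AV1 AV2 V12 e1 e2] F W P WF Wn Pn Pout Wmeet Winj.
  have [R0 [R0F R0card rep]] := above_representatives F (P :|: [set [set v] | v in A]).
  exists (W :|: R0), [seq i |: (W :|: R0) | i <- enum F].
  have [| | |rp _ bnd cov con] :=
      @star_support (2 ^ (4 * t.+1)) F (W :|: R0) (P :|: [set [set v] | v in A]).
  - by rewrite subUset WF.
  - apply: leq_trans (width_bound t); rewrite four; apply: cardsU_leq.
      by rewrite -addnA (leq_trans Wn) ?leq_addr.
    by apply: leq_trans R0card _; apply: cardsU_leq => //; apply: leq_trans (leq_imset_card _ _) Ak.
  - move=> l i lP il; have [j jR jl] := rep l i lP il.
    by exists j; rewrite // inE jR orbT.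
  by split=> //; apply: subsetUl.
set V := A :|: V1 :|: V2 in Pout Wmeet Winj *; set U := ~: V :|: A in Pout Wmeet Winj.
pose C1 := V1 :\: A; pose C2 := V2 :\: A.
have cl1 : sealed A C1.
  by move=> u v uC /(e1 u v uC); rewrite !inE; case: (v \in A); rewrite ?orbT ?orbF.
have cl2 : sealed A C2.
  by move=> u v uC /(e2 u v uC); rewrite !inE; case: (v \in A); rewrite ?orbT ?orbF.
have d12 : [disjoint C1 & C2].
  rewrite -setI_eq0; apply/eqP/setP=> v; rewrite !inE.
  have := subsetP V12 v; rewrite !inE; case: (v \in A) => //=.
  by case: (v \in V1) => //=; case: (v \in V2) => //= /(_ isT).
have UC1 : U \subset ~: C1.
  by apply/subsetP=> v; rewrite !inE; case: (v \in A); case: (v \in V1); rewrite ?orbT.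
have UC2 : U \subset ~: C2.
  by apply/subsetP=> v; rewrite !inE; case: (v \in A); case: (v \in V2); rewrite ?orbT.
(* Members of [W] already differ on [U], which lies outside either side. *)
have injC (C : {set T}) : U \subset ~: C ->
    {in W &, forall w w', H w :&: ~: C = H w' :&: ~: C -> w = w'}.
  move=> /setIidPr UC w w' wW w'W eq; apply: Winj => //.
  by rewrite -UC !setIA eq.
have [g1 [g2 [gt gtr]]] := top_pair_choice (A := A) cl1 cl2 d12 (injC _ UC1) (injC _ UC2) WF.
have gt1 i : i \in F -> top A C1 F W (H i :&: A) (g1 i) by case/gt.
have gt2 i : i \in F -> top A C2 F W (H i :&: A) (g2 i) by case/gt.
have gr1 : {in F &, forall i j, H i :&: A = H j :&: A -> g1 i = g1 j}.
  by move=> i j iF jF /(gtr i j iF jF)[].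
have gr2 : {in F &, forall i j, H i :&: A = H j :&: A -> g2 i = g2 j}.
  by move=> i j iF jF /(gtr i j iF jF)[].
have pw : 2 ^ #|A| <= 2 ^ t.+1 by rewrite leq_exp2l.
have [r1 [s1 sup1]] := side_support Ak AV1 gt1 gr1 IH1.
have [r2 [s2 sup2]] := side_support Ak AV2 gt2 gr2 IH2.
set F0 := core_members A C1 C2 F g1 g2.
have WF0 : W \subset F0 by apply: (@W_core A C1 C2 F W g1 g2 gt U).
have [R0 [R0F R0card rep]] := above_representatives F0 (P :|: [set [set v] | v in A]).
exists (hubs A F g1 :|: hubs A F g2 :|: W :|: R0); eexists.
apply: (bag_supportS (P := (P :|: [set [set v] | v in A]) :|:
  [set [set v] | v in C1] :|: [set [set v] | v in C2])).
  apply/subsetP=> l; rewrite !in_setU => /orP[->//|/imsetP[v vV ->]].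
  have [vA|vA] := boolP (v \in A).
    have -> : [set v] \in [set [set v] | v in A] by apply: imset_f.
    by rewrite !orbT.
  move: vV; rewrite !inE (negbTE vA) /= => /orP[vV|vV].
    have -> : [set v] \in [set [set v] | v in C1] by apply: imset_f; rewrite inE vA.
    by rewrite !orbT.
  have -> : [set v] \in [set [set v] | v in C2] by apply: imset_f; rewrite inE vA.
  by rewrite !orbT.
apply: (node_support (W := W) cl1 cl2 d12 gt gtr _ _ _ _ _ sup1 sup2).
- by rewrite !subUset WF0 R0F (hubs1_core gt gtr) (hubs2_core gt gtr).
- exact: subsetUl.
- apply: leq_trans (width_bound t); rewrite four; apply: cardsU_leq.
    apply: cardsU_leq => //; apply: cardsU_leq.
      exact: leq_trans (card_hubs gt1 gr1) pw.
    exact: leq_trans (card_hubs gt2 gr2) pw.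
  by apply: leq_trans R0card _; apply: cardsU_leq => //; apply: leq_trans (leq_imset_card _ _) Ak.
- move=> l i lP il; have [j jR jl] := rep l i lP il.
  by exists j; rewrite // inE jR orbT.
move=> l; rewrite inE => /orP[/Pout/andP[l0 lU]|/imsetP[v vA ->]].
  by rewrite l0 (subset_trans lU UC1) (subset_trans lU UC2).
rewrite !sub1set !inE vA; split=> //; by apply/set0Pn; exists v; rewrite inE.
Qed.

End DualSupport.

(** * The dual support of the whole graph *)

Theorem mainTheorem2 (T : finType) (e : rel T) (t : nat)
  (I : finType) (H : I -> {set T}) :
  simple_graph e -> treewidth e t -> non_piercing e H ->
  exists Q : rel I,
    simple_graph Q /\ dual_support e H Q /\ tw_le Q (2 ^ (4 * t.+1)).
Proof.
move=> _ [/rooted_dec_exists[A decA] _] [Hc Hd].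
(* At the top nothing lies outside, so [W] and [P] are empty and only single vertices prescribe
   links. *)
have [||||||r [s [rp _ bnd cov con]]] :=
  @rooted_dec_supportable T I e H Hc Hd t _ _ decA [set: I] set0 set0;
  rewrite ?sub0set ?cards0 //; try by move=> x; rewrite inE.
exists [rel x y | (x != y) && cobag (r :: s) x y]; split; last split.
- split=> [x y|x]; last by rewrite /= eqxx.
  by rewrite /= eq_sym cobag_sym.
- move=> v x y; rewrite !inE => vx vy.
  have sv : [set v] \in set0 :|: [set [set v] | v in [set: T]].
    by rewrite inE; apply/orP; right; apply: imset_f.
  have := con _ sv x y; rewrite !inE !sub1set => /(_ vx vy).
  apply: connect_sub => a b; rewrite /induced /= !inE !sub1set /= => /and3P[va vb ab].
  have [->|nab] := eqVneq a b; first exact: connect0.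
  by apply: connect1; rewrite /= !inE va vb nab.
- by apply: rip_tw_le => // x; rewrite cov inE.
Qed.
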